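(* Let $\mathfrak{N}$ be a nest in a vector space $\mathfrak{X}$ over a field $\mathbb{F}$ and let $\mathcal{A}=\operatorname{Alg}\mathfrak{N}$. Then the linear span of the rank-one operators in $\mathcal{A}$ is dense in $\mathcal{A}$ for the strict topology on $\mathcal{L}(\mathfrak{X})$.
   Context: $\mathfrak{X}$ is an arbitrary vector space over a field $\mathbb{F}$, and $\mathcal{L}(\mathfrak{X})$ is the algebra of all linear operators $\mathfrak{X}\to\mathfrak{X}$. A nest $\mathfrak{N}$ in $\mathfrak{X}$ is a set of subspaces of $\mathfrak{X}$, totally ordered by inclusion, containing $\{0\}$ and $\mathfrak{X}$, and complete, i.e. closed under arbitrary intersections and arbitrary unions of its members (the empty union being $\{0\}$ and the empty intersection being $\mathfrak{X}$). $\operatorname{Alg}\mathfrak{N}$ is the algebra of all $T\in\mathcal{L}(\mathfrak{X})$ with $T(M)\subseteq M$ for every $M\in\mathfrak{N}$. The rank of an operator is the dimension of its range. The strict topology on $\mathcal{L}(\mathfrak{X})$ is the topology for which the sets $\mathcal{U}(T,x)=\{S\in\mathcal{L}(\mathfrak{X}):Sx=Tx\}$, $x\in\mathfrak{X}$, are the subbasic neighbourhoods of $T$, for each $T\in\mathcal{L}(\mathfrak{X})$. *)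

(* Defs.v *)
From HB Require Import structures.
From mathcomp Require Import all_boot all_algebra.
From mathcomp Require Import all_classical topology.

Set Implicit Arguments.
Unset Strict Implicit.
Unset Printing Implicit Defensive.

Import GRing.Theory.

Local Open Scope classical_set_scope.
Local Open Scope ring_scope.

Section Subspaces.
Context {F : fieldType} {V : lmodType F}.
Implicit Types (A M : set V).

Definition is_subspace M : Prop := GRing.submod_closed [in M].

Definition linear_span A : set V :=
  [set v | exists n (c : 'I_n -> F) (e : 'I_n -> V),
     (forall i, A (e i)) /\ v = \sum_(i < n) c i *: e i].

Definition lin_indep n (e : 'I_n -> V) : Prop :=
  forall c : 'I_n -> F, \sum_(i < n) c i *: e i = 0 -> forall i, c i = 0.

Definition has_dim M (n : nat) : Prop :=
  exists e : 'I_n -> V, lin_indep e /\ linear_span (range e) = M.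

End Subspaces.

(* The space of all linear operators on X.  It is an alias so that it can carry
   the strict topology. *)
Definition linop {F : fieldType} (X : lmodType F) : Type := {linear X -> X}.

Section LinopLmodule.
Context {F : fieldType} {X : lmodType F}.
Implicit Types (S T : linop X) (a : F).

HB.instance Definition _ := gen_eqMixin (linop X).
HB.instance Definition _ := gen_choiceMixin (linop X).

Lemma linop_ext S T : (forall x, S x = T x) -> S = T.
Proof.
case: S T => [f [[fB] [fZ]]] [g [[gB] [gZ]]] /= fg.
have efg : f = g by apply/funext.
case: _ / efg in gB gZ *.
by rewrite (Prop_irrelevance fB gB) (Prop_irrelevance fZ gZ).
Qed.

Definition linop_zero : linop X := \0.
Definition linop_opp T : linop X := \- T.
Definition linop_add S T : linop X := S \+ T.
Definition linop_scale a T : linop X := a \*: T.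

Fact linop_addA : associative linop_add.
Proof. by move=> S T U; apply: linop_ext => x /=; rewrite addrA. Qed.
Fact linop_addC : commutative linop_add.
Proof. by move=> S T; apply: linop_ext => x /=; rewrite addrC. Qed.
Fact linop_add0 : left_id linop_zero linop_add.
Proof. by move=> T; apply: linop_ext => x /=; rewrite add0r. Qed.
Fact linop_addN : left_inverse linop_zero linop_opp linop_add.
Proof. by move=> T; apply: linop_ext => x /=; rewrite addNr. Qed.

HB.instance Definition _ := GRing.isZmodule.Build (linop X)
  linop_addA linop_addC linop_add0 linop_addN.

Fact linop_scaleA a b T :
  linop_scale a (linop_scale b T) = linop_scale (a * b) T.
Proof. by apply: linop_ext => x /=; rewrite scalerA. Qed.
Fact linop_scale1 : left_id 1 linop_scale.
Proof. by move=> T; apply: linop_ext => x /=; rewrite scale1r. Qed.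
Fact linop_scaleDr : right_distributive linop_scale +%R.
Proof. by move=> a S T; apply: linop_ext => x /=; rewrite scalerDr. Qed.
Fact linop_scaleDl T : {morph linop_scale^~ T : a b / a + b}.
Proof. by move=> a b; apply: linop_ext => x /=; rewrite scalerDl. Qed.

HB.instance Definition _ := GRing.Zmodule_isLmodule.Build F (linop X)
  linop_scaleA linop_scale1 linop_scaleDr linop_scaleDl.

End LinopLmodule.

Section StrictTopology.
Context {F : fieldType} {X : lmodType F}.

Definition strict_nbhs (T : linop X) (x : X) : set (linop X) :=
  [set S : linop X | S x = T x].

Definition strict_subbase : set (set (linop X)) :=
  [set U | exists T x, U = strict_nbhs T x].

(* The topological structure of [linop X] is the strict topology. *)
HB.instance Definition _ :=
  isSubBaseTopological.Build (linop X) strict_subbase id.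

End StrictTopology.

Definition dense_in {T : topologicalType} (S A : set T) : Prop :=
  S `<=` A /\ A `<=` closure S.

Section Nests.
Context {F : fieldType} {X : lmodType F}.

(* The union of the empty family is {0} by convention, which [nest_0] covers. *)
Record is_nest (N : set (set X)) : Prop := IsNest {
  nest_subspace : forall M, N M -> is_subspace M;
  nest_total : total_on N subset;
  nest_0 : N [set 0];
  nest_X : N [set: X];
  nest_bigcap : forall G : set (set X), G `<=` N -> N (\bigcap_(M in G) M);
  nest_bigcup : forall G : set (set X), G `<=` N -> G !=set0 ->
    N (\bigcup_(M in G) M)
}.

Definition Alg (N : set (set X)) : set (linop X) :=
  [set T : linop X | forall M, N M -> T @` M `<=` M].

Definition has_rank (T : linop X) (n : nat) : Prop := has_dim (range T) n.

End Nests.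

(* Main.v *)
From HB Require Import structures.
Require Import Defs.
From mathcomp Require Import all_boot all_algebra.
From mathcomp Require Import all_classical topology.

(** The strict topology only sees finitely many vectors at a time, so density
    says: for [T] in [Alg N] and vectors [x_1, ..., x_n], some sum [R] of
    rank-one operators of [Alg N] agrees with [T] at every [x_i]
    ([rank_one_interpolation], [nbhs_strict]).

    Such an [R] is built one vector at a time.  If [R] already agrees with [T]
    at [x_2, ..., x_n], the error [S = T - R] is in [Alg N] and kills these
    vectors; if [S x_1] is not [0], one has to add to [R] a rank-one operator
    [Q] of [Alg N] with [Q x_1 = S x_1] that still kills them.  It is enough
    that [ker S] lies in [ker Q] ([rank_one_correction]).

    Look for [Q = f(-) S x_1] with [f] a linear functional and [f x_1 = 1].  Let
    [W] be the union of the subspaces [S^-1(S L)], where [L] runs over the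
    members of [N] such that [S x_1] is not in [S L].  The union is directed
    because [N] is a chain, so [W] is a subspace; it contains [ker S] (take
    [L = 0]) and not [x_1].  Hence some [f] vanishes on [W] with [f x_1 = 1]
    ([separating_functional], by Zorn).  This [Q] preserves every [L] in [N]:
    if [S x_1] is in [S L] then it is in [L], because [S] preserves [L], and so
    is the range of [Q]; otherwise [L] lies in [W], where [Q] is zero. *)

Import GRing.Theory.

Local Open Scope classical_set_scope.

Section StrictDensity.
Set Implicit Arguments.
Unset Strict Implicit.
Unset Printing Implicit Defensive.
Local Open Scope ring_scope.
Context {F : fieldType} {X : lmodType F}.
Implicit Types (M W : set X) (x y v : X) (S T Q R : linop X) (N : set (set X)).

(** * Subspaces and separation by functionals *)

Lemma is_subspaceP M : is_subspace M <->
  M 0 /\ (forall (a : F) u v, M u -> M v -> M (a *: u + v)).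
Proof.
split=> [[M0 ML]|[M0 ML]]; split; rewrite ?inE //.
- by move: M0; rewrite inE.
- move=> a u v Mu Mv; suff : a *: u + v \in [in M] by rewrite inE.
  by apply: ML; rewrite inE.
- by move=> a u v; rewrite !inE; apply: ML.
Qed.

Lemma subspaceZ M (a : F) v : is_subspace M -> M v -> M (a *: v).
Proof. by move=> /is_subspaceP[M0 ML] Mv; rewrite -[_ *: _]addr0; apply: ML. Qed.

(** Zorn's lemma is applied to sets stable under linear combinations and under
    translation by [W], rather than to subspaces containing [W]: unlike the
    latter, these include the empty set, the union of the empty chain. *)
Lemma maximal_subspace_avoiding W x : is_subspace W -> ~ W x ->
  exists M, [/\ is_subspace M, W `<=` M, ~ M x &
    forall y, ~ M y -> exists2 c : F, M (x - c *: y) & c != 0].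
Proof.
move=> /is_subspaceP[W0 WL] Wx.
pose P M := [/\ forall (a : F) u v, M u -> M v -> M (a *: u + v),
  forall u w, M u -> W w -> M (u + w) & ~ M x].
have [G GP Gtot|M [[ML MW Mx] Mmax]] := @Zorn_bigcup _ P.
  split.
  - move=> a u v [A GA Au] [B GB Bv].
    have [sAB|sBA] := Gtot _ _ GA GB.
      by exists B => //; have [BL _ _] := GP _ GB; apply: BL => //; exact: sAB.
    by exists A => //; have [AL _ _] := GP _ GA; apply: AL => //; exact: sBA.
  - move=> u w [A GA Au] Ww; exists A => //.
    by have [_ AW _] := GP _ GA; apply: AW.
  - by move=> [A GA Ax]; have [_ _] := GP _ GA.
have M0 : M 0.
  have [u Mu] : M !=set0.
    apply: contrapT => /nonemptyPn Me; apply: (Mmax W).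
      by rewrite Me; split=> // /(_ 0 W0).
    by split=> // u w Wu Ww; rewrite -[u]scale1r; apply: WL.
  by rewrite -(addNr u) -scaleN1r; apply: ML.
have subM : is_subspace M by apply/is_subspaceP.
exists M; split=> // [w Ww|y My]; first by rewrite -[w]add0r; apply: MW.
pose B := [set u | exists c : F, M (u - c *: y)].
have Bx : B x.
  apply: contrapT => nBx; apply: (Mmax B).
    split=> [u Mu|sBM]; first by exists 0; rewrite scale0r subr0.
    by apply: My; apply: sBM; exists 1; rewrite scale1r subrr.
  split=> // [a u v [c Mc] [d Md]|u w [c Mc] Ww].
    exists (a * c + d); rewrite scalerDl -scalerA opprD addrACA -scalerBr.
    exact: ML.
  by exists c; rewrite addrAC; apply: MW.
have [c Mc] := Bx; exists c => //.
by apply/eqP => c0; move: Mc; rewrite c0 scale0r subr0.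
Qed.

(** A maximal subspace [M] avoiding [x] is a complement of the line through
    [x]; the functional is the coordinate along this line. *)
Lemma separating_functional W x : is_subspace W -> ~ W x ->
  exists f : {linear X -> F^o}, (forall w, W w -> f w = 0) /\ f x = 1.
Proof.
move=> subW Wx.
have [M [subM sWM Mx Mmax]] := maximal_subspace_avoiding subW Wx.
have [M0 ML] := (is_subspaceP M).1 subM.
have /choice[f fP] : forall y, exists c : F, M (y - c *: x).
  move=> y; have [My|/Mmax[c Mc c0]] := pselect (M y).
    by exists 0; rewrite scale0r subr0.
  exists c^-1; have /(subspaceZ (- c^-1) subM) := Mc.
  by rewrite scalerBr !scaleNr opprK scalerA mulVf // scale1r addrC.
have fE y (c : F) : M (y - c *: x) -> f y = c.
  move=> Mc; apply/eqP; rewrite -subr_eq0; apply/negP => /negP fc; apply: Mx.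
  have := ML (-1) _ _ (fP y) Mc.
  rewrite scaleN1r opprB addrA subrK -scalerBl => /(subspaceZ (f y - c)^-1 subM).
  by rewrite scalerA mulVf // scale1r.
have fL : linear (f : X -> F^o).
  move=> a u v; apply: fE.
  by rewrite scalerDl -scalerA opprD addrACA -scalerBr; apply: ML.
pose g : {linear X -> F^o} :=
  HB.pack (f : X -> F^o) (GRing.isLinear.Build F X F^o *:%R f fL).
exists g; split=> [w Ww|]; first by apply: fE; rewrite scale0r subr0; exact: sWM.
by apply: fE; rewrite scale1r subrr.
Qed.

(** * Rank-one operators *)

Definition rank_one (f : {linear X -> F^o}) v : X -> X := fun y => f y *: v.

Fact rank_one_is_linear f v : linear (rank_one f v).
Proof. by move=> a y z; rewrite /rank_one linearP scalerDl scalerA. Qed.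

HB.instance Definition _ f v :=
  GRing.isLinear.Build F X X *:%R (rank_one f v) (rank_one_is_linear f v).

Lemma has_rank_rank_one (f : {linear X -> F^o}) x v : f x = 1 -> v != 0 ->
  has_rank (rank_one f v : linop X) 1.
Proof.
move=> fx v0; exists (fun=> v); split.
  move=> c; rewrite big_ord1 => /eqP; rewrite scaler_eq0 (negPf v0) orbF.
  by move=> /eqP c0 i; rewrite ord1.
apply/seteqP; split=> [_ [n [c [e [eP ->]]]]|_ [y _ <-]].
  exists (\sum_(i < n) c i *: x) => //=; rewrite /rank_one linear_sum scaler_suml.
  apply: eq_bigr => i _; have [_ _ <-] := eP i.
  by rewrite linearZ /= fx /GRing.scale /= mulr1.
exists 1%N, (fun=> f y), (fun=> v); rewrite big_ord1; split=> // _.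
by exists ord0.
Qed.

Lemma Alg0 N : is_nest N -> Alg N 0.
Proof.
by move=> hN M NM _ [x _ <-]; have [] := (is_subspaceP M).1 (nest_subspace hN NM).
Qed.

Lemma AlgZD N (a : F) S T : is_nest N ->
  Alg N S -> Alg N T -> Alg N (a *: S + T).
Proof.
move=> hN NS NT M NM _ [x Mx <-].
have [_ ML] := (is_subspaceP M).1 (nest_subspace hN NM).
by apply: ML; [apply: NS NM _ _|apply: NT NM _ _]; exists x.
Qed.

Lemma linear_span_Alg N (A : set (linop X)) : is_nest N ->
  A `<=` Alg N -> linear_span A `<=` Alg N.
Proof.
move=> hN sAN _ [n [c [e [eA ->]]]].
elim/big_ind : _ => [|S T NS NT|i _]; first exact: Alg0.
  by rewrite -[S]scale1r; apply: AlgZD.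
by rewrite -[_ *: _]addr0; apply: AlgZD => //; [exact: sAN|exact: Alg0].
Qed.

Lemma linear_span0 (A : set (linop X)) : linear_span A 0.
Proof.
by exists 0%N, (fun=> 0), (fun=> 0); rewrite big_ord0; split=> // -[].
Qed.

Lemma linear_spanD1 (A : set (linop X)) R Q :
  linear_span A R -> A Q -> linear_span A (Q + R).
Proof.
move=> [n [c [e [eA ->]]]] AQ.
exists n.+1, (fun i => oapp c 1 (unlift ord0 i)),
  (fun i => oapp e Q (unlift ord0 i)); split.
  by move=> i; case: unliftP => [j|] _ /=.
rewrite big_ord_recl unlift_none /= scale1r; congr (_ + _).
by apply: eq_bigr => i _; rewrite liftK.
Qed.

(** * Interpolation by rank-one operators of the algebra *)

(** The union [W] of the subspaces [S^-1(S L)] is described by the images of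
    its elements: [y] is in [W] when [S y] is in some [S L] avoiding [S x]. *)
Lemma rank_one_correction N S x : is_nest N -> Alg N S -> S x != 0 ->
  exists Q, [/\ Alg N Q, has_rank Q 1, Q x = S x &
    forall y, S y = 0 -> Q y = 0].
Proof.
move=> hN NS Sx0.
pose W := [set y | exists L, [/\ N L, ~ (S @` L) (S x) & (S @` L) (S y)]].
have subW : is_subspace W.
  apply/is_subspaceP; split.
    exists [set 0]; split; first exact: nest_0.
      by move=> [_ -> Sx]; rewrite -Sx linear0 eqxx in Sx0.
    by exists 0.
  move=> a u v [L [NL Lx [u' Lu' Su]]] [K [NK Kx [v' Kv' Sv]]].
  have comb M : N M -> M u' -> M v' -> (S @` M) (S (a *: u + v)).
    move=> /(nest_subspace hN)/is_subspaceP[_ ML] Mu Mv.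
    by exists (a *: u' + v'); [exact: ML|rewrite !linearP Su Sv].
  have [sLK|sKL] := nest_total hN NL NK.
    by exists K; split=> //; apply: comb => //; exact: sLK.
  by exists L; split=> //; apply: comb => //; exact: sKL.
have [|f [fW fx]] := @separating_functional W x subW; first by move=> [L []].
exists (rank_one f (S x) : linop X); split.
- move=> L NL _ [y Ly <-] /=; rewrite /rank_one.
  have subL := nest_subspace hN NL.
  have [[z Lz <-]|Lx] := pselect ((S @` L) (S x)).
    by apply: subspaceZ => //; apply: NS NL _ _; exists z.
  rewrite fW ?scale0r; first by have [] := (is_subspaceP L).1 subL.
  by exists L; split=> //; exists y.
- exact: has_rank_rank_one fx Sx0.
- by rewrite /= /rank_one fx scale1r.
- move=> y Sy; rewrite /= /rank_one fW ?scale0r //.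
  exists [set 0]; split; first exact: nest_0.
    by move=> [_ -> Sx]; rewrite -Sx linear0 eqxx in Sx0.
  by exists 0; rewrite ?linear0.
Qed.

Lemma rank_one_interpolation N T (s : seq X) : is_nest N -> Alg N T ->
  exists2 R, linear_span [set Q : linop X | Alg N Q /\ has_rank Q 1] R &
    {in s, R =1 T}.
Proof.
move=> hN NT; elim: s => [|x s [R spanR Rs]].
  by exists 0 => //; exact: linear_span0.
have NR : Alg N R by apply: linear_span_Alg spanR => // Q [].
have NS : Alg N (T - R) by rewrite addrC -scaleN1r; exact: AlgZD.
have [Sx0|Sx0] := eqVneq ((T - R : linop X) x) 0.
  exists R => // y; rewrite inE => /predU1P[->|/Rs//].
  by apply/esym/eqP; rewrite -subr_eq0; apply/eqP.
have [Q [NQ rkQ Qx Qker]] := rank_one_correction hN NS Sx0.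
exists (Q + R); first exact: linear_spanD1.
move=> y; rewrite inE => /predU1P[->|ys].
  by rewrite [LHS](_ : _ = Q x + R x) // Qx [X in X + _](_ : _ = T x - R x) ?subrK.
rewrite [LHS](_ : _ = Q y + R y) // Qker ?add0r ?Rs //.
by rewrite [LHS](_ : _ = T y - R y) // Rs // subrr.
Qed.

(** * The strict topology *)

Lemma strict_subbase_agree T (l : seq (set (linop X))) :
  (forall U, U \in l -> strict_subbase U /\ U T) ->
  exists s : seq X, forall S, {in s, S =1 T} -> forall U, U \in l -> U S.
Proof.
elim: l => [|U l IH] lP; first by exists [::].
have [|s sP] := IH; first by move=> V Vl; apply: lP; rewrite inE Vl orbT.
have [[T' [x Ux]] UT] := lP U (mem_head _ _).
(* [T] itself lies in [U], so the centre of [U] may be moved to [T]. *)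
have Tx : T x = T' x by rewrite Ux in UT.
exists (x :: s) => S Ss V; rewrite inE => /predU1P[->|Vl].
  by rewrite Ux /strict_nbhs /= -Tx; exact: Ss (mem_head _ _).
by apply: sP Vl => y ys; apply: Ss; rewrite inE ys orbT.
Qed.

Lemma nbhs_strict T (B : set (linop X)) : nbhs T B ->
  exists s : seq X, forall S, {in s, S =1 T} -> B S.
Proof.
move=> [A [[D sD <-] [E DE ET] sAB]].
have [G sG EG] := sD _ DE.
have GE S : (E : set (linop X)) S <->
    forall U : set (linop X), U \in finmap.enum_fset G -> U S.
  by rewrite -EG.
have [|s sP] := @strict_subbase_agree T (finmap.enum_fset G).
  by move=> U GU; split; [exact/set_mem/(sG U GU)|exact: (GE T).1 ET U GU].
by exists s => S Ss; apply: sAB; exists E => //; apply/GE; exact: sP.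
Qed.

End StrictDensity.

Theorem theorem10 (F : fieldType) (X : lmodType F) (N : set (set X))
    (hN : is_nest N) :
  dense_in (linear_span [set T : linop X | Alg N T /\ has_rank T 1]) (Alg N).
Proof.
split=> [|T NT B /nbhs_strict[s sB]]; first by apply: linear_span_Alg => // Q [].
have [R spanR Rs] := rank_one_interpolation s hN NT.
by exists R; split=> //; exact: sB.
Qed.
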